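(* Let $\bm{\theta}\in\mathbb{R}^D$ be a parameter vector of the three-layer network with $\sigma(\bm{\theta})>0$. Then the steepest descent direction (negative gradient) of the Wolkowicz–Styan upper bound $\lambda_{\mathrm{sup}}$ at $\bm{\theta}$ is $$-\frac{\partial \lambda_{\mathrm{sup}}(\bm{\theta})}{\partial \bm{\theta}} = -\frac{\partial \mu(\bm{\theta})}{\partial \bm{\theta}} - \sqrt{D-1}\,\frac{\partial \sigma(\bm{\theta})}{\partial \bm{\theta}},$$ where $$\frac{\partial \mu(\bm{\theta})}{\partial \bm{\theta}} = \frac{1}{D}\frac{\partial\, \mathrm{tr}(\bm{H}_L(\bm{\theta}))}{\partial \bm{\theta}},\qquad \frac{\partial \sigma(\bm{\theta})}{\partial \bm{\theta}} = \frac{1}{2\sigma(\bm{\theta})D}\frac{\partial\, \mathrm{tr}(\bm{H}_L(\bm{\theta})^2)}{\partial \bm{\theta}} - \frac{\mu(\bm{\theta})}{\sigma(\bm{\theta})}\frac{\partial \mu(\bm{\theta})}{\partial \bm{\theta}}.$$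
   Context: Network. Let $M,N,I\ge 1$ be integers and $f:\mathbb{R}\to\mathbb{R}$ a three times differentiable activation function; $\bm{f}(\bm{y})=[f(y_1),\dots,f(y_N)]^\top$ for $\bm{y}\in\mathbb{R}^N$. For a vector $\bm{u}$, $\bm{h}(\bm{u})=[1\ \ \bm{u}^\top]^\top$. Parameters: $\bm{W}=[\bm{b}\ \ \widetilde{\bm{W}}]\in\mathbb{R}^{N\times(M+1)}$ with $\bm{b}\in\mathbb{R}^N$, $\widetilde{\bm{W}}\in\mathbb{R}^{N\times M}$, and $\bm{V}=[c\ \ \widetilde{\bm{V}}]\in\mathbb{R}^{1\times(N+1)}$ with $c\in\mathbb{R}$, $\widetilde{\bm{V}}\in\mathbb{R}^{1\times N}$. Let $\bm{w}\in\mathbb{R}^{(M+1)N}$ be the vertical concatenation of the columns of $\bm{W}$ (in order), $\bm{v}=\bm{V}^\top\in\mathbb{R}^{N+1}$, and $\bm{\theta}=[\bm{w}^\top\ \bm{v}^\top]^\top\in\mathbb{R}^D$, $D=MN+2N+1$. For training data $\bm{x}_i\in\mathbb{R}^M$ with labels $q_i\in\{0,1\}$, $i=1,\dots,I$, put $\bm{y}_i=\bm{W}\bm{h}(\bm{x}_i)$, $z_i=\bm{V}\bm{h}(\bm{f}(\bm{y}_i))$, $p_i=s(z_i)$, where $s(z)=1/(1+e^{-z})$. Loss: $L(\bm{\theta})=-\sum_{i=1}^I\big(q_i\log p_i+(1-q_i)\log(1-p_i)\big)$. $\bm{H}_L(\bm{\theta})\in\mathbb{R}^{D\times D}$ is the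 Hessian of $L$ with respect to $\bm{\theta}$. Eigenvalue statistics: $\mu(\bm{\theta})=\frac1D\mathrm{tr}(\bm{H}_L(\bm{\theta}))$, $\sigma(\bm{\theta})^2=\frac1D\mathrm{tr}(\bm{H}_L(\bm{\theta})^2)-\mu(\bm{\theta})^2$ with $\sigma(\bm{\theta})\ge0$ (the mean and variance of the eigenvalues of $\bm{H}_L(\bm{\theta})$). The Wolkowicz–Styan upper bound is $\lambda_{\mathrm{sup}}(\bm{\theta})=\mu(\bm{\theta})+\sqrt{D-1}\,\sigma(\bm{\theta})$. The gradient $\partial/\partial\bm{\theta}$ of a scalar function is the column vector of its partial derivatives. *)

(* Defs.v *)
From HB Require Import structures.
From mathcomp Require Import all_boot all_order all_algebra.
From mathcomp Require Import all_classical all_reals all_analysis.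
From mathcomp Require Import zify.

Set Implicit Arguments.
Unset Strict Implicit.
Unset Printing Implicit Defensive.

Import Order.TTheory GRing.Theory Num.Theory.
Import numFieldNormedType.Exports.
Local Open Scope classical_set_scope.
Local Open Scope ring_scope.

Definition three_times_differentiable (R : realType) (f : R -> R) : Prop :=
  forall k : nat, (k < 3)%N -> forall y : R, derivable (derive1n k f) y 1.

Definition partial (R : realType) (n : nat) (k : 'I_n)
    (g : 'cV[R]_n -> R) (a : 'cV[R]_n) : R :=
  'D_(delta_mx k 0) g a.

Definition grad (R : realType) (n : nat)
    (g : 'cV[R]_n -> R) (a : 'cV[R]_n) : 'cV[R]_n :=
  \col_(k < n) partial k g a.

Definition hessian (R : realType) (n : nat)
    (g : 'cV[R]_n -> R) (a : 'cV[R]_n) : 'M[R]_n :=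
  \matrix_(i < n, j < n) partial i (partial j g) a.

(* Written in this shape so that a parameter vector splits as
   theta = [w^T v^T]^T by usubmx / dsubmx; see nparamsE for the total.       *)
Definition nparams (M N : nat) : nat := ((1 + M) * N + (1 + N))%N.

Lemma nparamsE (M N : nat) : nparams M N = (M * N + 2 * N + 1)%N.
Proof. by rewrite /nparams; lia. Qed.

(* h(u) = [1 u^T]^T *)
Definition bias_ext (R : realType) (n : nat) (u : 'cV[R]_n) : 'cV[R]_(1 + n) :=
  col_mx 1%:M u.

(* mxvec and vec_mx are row-major, hence the transpositions: w stacks the
   columns of W = [b W~].                                                    *)
Definition theta_of (R : realType) (M N : nat)
    (W : 'M[R]_(N, 1 + M)) (V : 'rV[R]_(1 + N)) : 'cV[R]_(nparams M N) :=
  col_mx (mxvec W^T)^T V^T.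

Definition weightW (R : realType) (M N : nat)
    (theta : 'cV[R]_(nparams M N)) : 'M[R]_(N, 1 + M) :=
  (vec_mx (usubmx theta)^T)^T.

Definition weightV (R : realType) (M N : nat)
    (theta : 'cV[R]_(nparams M N)) : 'rV[R]_(1 + N) :=
  (dsubmx theta)^T.

Lemma weightWK (R : realType) (M N : nat)
    (W : 'M[R]_(N, 1 + M)) (V : 'rV[R]_(1 + N)) :
  weightW (theta_of W V) = W.
Proof. by rewrite /weightW /theta_of col_mxKu trmxK mxvecK trmxK. Qed.

Lemma weightVK (R : realType) (M N : nat)
    (W : 'M[R]_(N, 1 + M)) (V : 'rV[R]_(1 + N)) :
  weightV (theta_of W V) = V.
Proof. by rewrite /weightV /theta_of col_mxKd trmxK. Qed.

Definition preact (R : realType) (M N : nat) (xi : 'cV[R]_M)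
    (theta : 'cV[R]_(nparams M N)) : 'cV[R]_N :=
  weightW theta *m bias_ext xi.

Definition logit (R : realType) (M N : nat) (f : R -> R) (xi : 'cV[R]_M)
    (theta : 'cV[R]_(nparams M N)) : R :=
  (weightV theta *m bias_ext (map_mx f (preact xi theta))) 0 0.

Definition sigmoid (R : realType) (z : R) : R := (1 + expR (- z))^-1.

Definition output (R : realType) (M N : nat) (f : R -> R) (xi : 'cV[R]_M)
    (theta : 'cV[R]_(nparams M N)) : R :=
  sigmoid (logit f xi theta).

(* A label is a boolean, read as the real number 0 or 1.                     *)
Definition loss (R : realType) (M N I : nat) (f : R -> R)
    (x : 'I_I -> 'cV[R]_M) (q : 'I_I -> bool)
    (theta : 'cV[R]_(nparams M N)) : R :=
  - \sum_(i < I) ((q i)%:R * ln (output f (x i) theta)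
                  + (1 - (q i)%:R) * ln (1 - output f (x i) theta)).

Definition hessL (R : realType) (M N I : nat) (f : R -> R)
    (x : 'I_I -> 'cV[R]_M) (q : 'I_I -> bool)
    (theta : 'cV[R]_(nparams M N)) : 'M[R]_(nparams M N) :=
  hessian (loss f x q) theta.

Definition trH (R : realType) (M N I : nat) (f : R -> R)
    (x : 'I_I -> 'cV[R]_M) (q : 'I_I -> bool)
    (theta : 'cV[R]_(nparams M N)) : R :=
  \tr (hessL f x q theta).

Definition trH2 (R : realType) (M N I : nat) (f : R -> R)
    (x : 'I_I -> 'cV[R]_M) (q : 'I_I -> bool)
    (theta : 'cV[R]_(nparams M N)) : R :=
  \tr (hessL f x q theta *m hessL f x q theta).

Definition mu (R : realType) (M N I : nat) (f : R -> R)
    (x : 'I_I -> 'cV[R]_M) (q : 'I_I -> bool)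
    (theta : 'cV[R]_(nparams M N)) : R :=
  (nparams M N)%:R^-1 * trH f x q theta.

(* Num.sqrt is 0 on negative reals, so 0 < sigma theta forces the radicand
   to be positive and equal to (sigma theta) ^+ 2.                           *)
Definition sigma (R : realType) (M N I : nat) (f : R -> R)
    (x : 'I_I -> 'cV[R]_M) (q : 'I_I -> bool)
    (theta : 'cV[R]_(nparams M N)) : R :=
  Num.sqrt ((nparams M N)%:R^-1 * trH2 f x q theta - mu f x q theta ^+ 2).

Definition lambda_sup (R : realType) (M N I : nat) (f : R -> R)
    (x : 'I_I -> 'cV[R]_M) (q : 'I_I -> bool)
    (theta : 'cV[R]_(nparams M N)) : R :=
  mu f x q theta + Num.sqrt ((nparams M N)%:R - 1) * sigma f x q theta.

(* Main.v *)
(* The gradient formulas are the linearity of the gradient and the chain rule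
   for the square root, once tr H and tr H^2 are known to be Frechet
   differentiable. Since f is three times differentiable but not C^3, this
   cannot be read off continuity of the partial derivatives; instead, k-fold
   Frechet differentiability is shown to be preserved by sums, products and
   composition with scalar functions. The loss of one sample is such a
   composition, of z |-> q ln s(z) + (1 - q) ln(1 - s(z)), whose derivative is
   q - s(z), with s' = s (1 - s). *)

Require Import Defs.
From mathcomp Require Import all_boot all_order all_algebra.
From mathcomp Require Import all_classical all_reals all_analysis.
From mathcomp Require Import ring.
Set Implicit Arguments.
Unset Strict Implicit.
Unset Printing Implicit Defensive.

Import Order.TTheory GRing.Theory Num.Theory.
Import numFieldNormedType.Exports.
Local Open Scope classical_set_scope.
Local Open Scope ring_scope.

(** * Chain rule and iterated Frechet differentiability *)

Lemma derive_comp_scalar (R : realType) (V : normedModType R) (g : V -> R)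
    (phi : R -> R) (a v : V) :
  differentiable g a -> derivable phi (g a) 1 ->
  'D_v (phi \o g) a = 'D_1 phi (g a) * 'D_v g a.
Proof.
move=> dg /derivable1_diffP dphi.
rewrite !deriveE//; last exact: differentiable_comp.
rewrite diff_comp//= -[X in 'd phi _ X = _]mulr1.
by rewrite -[X in 'd phi _ X]/('d g a v *: 1) linearZ/= mulrC.
Qed.

(** Iterating derivatives along fixed directions keeps every function scalar-valued. In finite
    dimension this is k-fold Frechet differentiability, with no continuity asked of the top
    derivative; order 0 imposes nothing. *)
Fixpoint ndiff (R : realType) (V : normedModType R) (k : nat) (g : V -> R) :
    Prop :=
  if k is k'.+1 then
    (forall a, differentiable g a) /\ forall v, ndiff k' (fun a => 'D_v g a)
  else True.

Section ndiff_theory.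
Variables (R : realType) (V : normedModType R).
Implicit Types (g h : V -> R) (k : nat).

Lemma ndiffW k g : ndiff k.+1 g -> ndiff k g.
Proof. by elim: k g => // k IH g [dg Dg]; split=> // v; apply: IH; apply: Dg. Qed.

Lemma ndiff_cst k (c : R) : ndiff k (fun _ : V => c).
Proof.
elim: k c => // k IH c; split=> [a|v]; first exact: differentiable_cst.
by under eq_fun do rewrite derive_cst; exact: IH.
Qed.

Lemma ndiffD k g h : ndiff k g -> ndiff k h -> ndiff k (fun a => g a + h a).
Proof.
elim: k g h => // k IH g h [dg Dg] [dh Dh].
split=> [a|v]; first exact: (@differentiableD _ _ _ g h a (dg a) (dh a)).
rewrite (_ : (fun a => _) = fun a => 'D_v g a + 'D_v h a).
  exact: IH (Dg v) (Dh v).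
by apply/funext => a; rewrite -deriveD//; apply: diff_derivable.
Qed.

Lemma ndiff_sum k n (F : 'I_n -> V -> R) :
  (forall i, ndiff k (F i)) -> ndiff k (fun a => \sum_(i < n) F i a).
Proof.
move=> DF; rewrite (_ : (fun a => _) = \sum_(i < n) F i).
  elim/big_ind : _ => //; first exact: (ndiff_cst k (0 : R)).
  by move=> g h; exact: ndiffD.
by apply/funext => a; rewrite fct_sumE.
Qed.

(** Induction through the Leibniz rule: each term pairs a derivative with an undifferentiated
    factor, whose order [ndiffW] lowers to match. *)
Lemma ndiffM k g h : ndiff k g -> ndiff k h -> ndiff k (fun a => g a * h a).
Proof.
elim: k g h => // k IH g h Sg Sh; have [dg Dg] := Sg; have [dh Dh] := Sh.
split=> [a|v]; first exact: (@differentiableM _ _ g h a (dg a) (dh a)).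
rewrite (_ : (fun a => _) = fun a => g a * 'D_v h a + h a * 'D_v g a).
  by apply: ndiffD; [exact: IH (ndiffW Sg) (Dh v)|exact: IH (ndiffW Sh) (Dg v)].
by apply/funext => a; rewrite -deriveM//; apply: diff_derivable.
Qed.

Lemma ndiff_comp k (phi : R -> R) g :
  ndiff k phi -> ndiff k g -> ndiff k (phi \o g).
Proof.
elim: k phi g => // k IH phi g [dphi Dphi] Sg; have [dg Dg] := Sg.
split=> [a|v]; first exact: differentiable_comp.
(* The induction hypothesis covers the first factor because it is again a composition with [g], one
   order lower. *)
rewrite (_ : (fun a => _) = fun a => ('D_1 phi \o g) a * 'D_v g a).
  by apply: ndiffM (Dg v); exact: IH (Dphi 1) (ndiffW Sg).
apply/funext => a; rewrite derive_comp_scalar//; exact/derivable1_diffP.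
Qed.

End ndiff_theory.

Lemma ndiff_coord (R : realType) m n (k : nat) (i : 'I_m) (j : 'I_n) :
  ndiff k (fun A : 'M[R]_(m, n) => A i j).
Proof.
case: k => // k; split=> [a|v]; first exact: differentiable_coord.
rewrite (_ : (fun a => _) = fun=> v i j); first exact: ndiff_cst.
apply/funext => a.
have := derive_mx (M := id) (t := a) (v := v) (@derivable_id _ _ _ _).
by rewrite derive_id => /matrixP /(_ i j); rewrite !mxE.
Qed.

(** * Activation, sigmoid and cross-entropy on the real line *)

Lemma ndiff_real (R : realType) (k : nat) (phi dphi : R -> R) :
  (forall y : R, is_derive y 1 phi (dphi y)) -> ndiff k dphi -> ndiff k.+1 phi.
Proof.
move=> phiE Sdphi.
have dphi1 y : differentiable phi y.
  by apply/derivable1_diffP; case: (phiE y).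
split=> // v; rewrite (_ : (fun a => _) = fun y => v * dphi y).
  by apply: ndiffM => //; exact: ndiff_cst.
apply/funext => y; have [_ <-] := phiE y.
by rewrite !deriveE// -[v in LHS]mulr1 -[v * 1]/(v *: 1) linearZ.
Qed.

Lemma ndiff_derive1n (R : realType) (n : nat) (f : R -> R) :
  (forall k, (k < n)%N -> forall y : R, derivable (derive1n k f) y 1) -> ndiff n f.
Proof.
elim: n f => // n IH f df; apply: (@ndiff_real _ _ _ (derive1 f)).
  by move=> y; rewrite derive1E; apply: derivableP; exact: (df 0).
by apply: IH => k kn y; have := df k.+1 kn y; rewrite derive1Sn.
Qed.

Lemma is_derive_sigmoid (R : realType) (z : R) :
  is_derive z 1 (@sigmoid R) (sigmoid z * (1 - sigmoid z)).
Proof.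
have e0 := expR_gt0 (- z).
have n0 : 1 + expR (- z) != 0 by rewrite gt_eqF// addr_gt0.
have de : is_derive z 1 (fun y => 1 + expR (- y)) (0 + expR (- z) * -1).
  apply: is_deriveD; apply: (@is_derive1_comp _ expR -%R).
rewrite /sigmoid.
apply: is_derive_eq (@is_deriveV _ (fun y => 1 + expR (- y)) z _ _ n0 de) _.
by rewrite /GRing.scale/=; field.
Qed.

Lemma sigmoid_gt0 (R : realType) (z : R) : 0 < sigmoid z.
Proof. by rewrite invr_gt0 addr_gt0// expR_gt0. Qed.

Lemma sigmoid_lt1 (R : realType) (z : R) : sigmoid z < 1.
Proof. by rewrite invf_lt1 ?ltrDl ?addr_gt0// expR_gt0. Qed.

(** Bootstrapping: the derivative is a polynomial in [sigmoid] itself, so order k yields order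
    k+1. *)
Lemma ndiff_sigmoid (R : realType) (k : nat) : ndiff k (@sigmoid R).
Proof.
elim: k => // k IH; apply: ndiff_real (@is_derive_sigmoid R) _.
apply: ndiffM => //; apply: ndiffD; first exact: ndiff_cst.
under eq_fun do rewrite -mulN1r.
by apply: ndiffM => //; exact: ndiff_cst.
Qed.

Lemma is_derive_cross_entropy (R : realType) (c z : R) :
  is_derive z 1
    (fun y => c * ln (sigmoid y) + (1 - c) * ln (1 - sigmoid y))
    (c - sigmoid z).
Proof.
have s0 := sigmoid_gt0 z.
have s1 : 0 < 1 - sigmoid z by rewrite subr_gt0 sigmoid_lt1.
have ds := is_derive_sigmoid z.
have dl : is_derive z 1 (@ln R \o @sigmoid R)
    ((sigmoid z)^-1 * (sigmoid z * (1 - sigmoid z))).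
  exact: is_derive1_comp (is_derive1_ln s0) ds.
have dl1 : is_derive z 1 (@ln R \o (fun y : R => 1 - sigmoid y))
    ((1 - sigmoid z)^-1 * (0 - (sigmoid z * (1 - sigmoid z)))).
  apply: (@is_derive1_comp _ (@ln R) (fun y => 1 - sigmoid y)).
  exact: is_derive1_ln.
have := is_deriveD (is_deriveZ c dl) (is_deriveZ (1 - c) dl1).
move/is_derive_eq; apply.
(* With s the sigmoid, the two logarithmic derivatives are 1 - s and -s, and c(1 - s) - (1 - c)s = c
   - s. *)
by rewrite /GRing.scale/=; field; rewrite !gt_eqF.
Qed.

Lemma ndiff_cross_entropy (R : realType) (k : nat) (c : R) :
  ndiff k (fun y : R => c * ln (sigmoid y) + (1 - c) * ln (1 - sigmoid y)).
Proof.
(* Working from the derivative bypasses [ln], which is not differentiable on the whole line and so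
   cannot be fed to [ndiff_comp]. *)
apply/ndiffW/(ndiff_real (is_derive_cross_entropy c)).
apply: ndiffD; first exact: ndiff_cst.
under eq_fun do rewrite -mulN1r.
by apply: ndiffM; [exact: ndiff_cst|exact: ndiff_sigmoid].
Qed.

(** * Differentiability of the network and its loss *)

Section network.
Variables (R : realType) (M N I : nat) (f : R -> R) (x : 'I_I -> 'cV[R]_M).
Variables (q : 'I_I -> bool) (k : nat).
Hypothesis Df : ndiff k f.

Lemma ndiff_weightW (i : 'I_N) (j : 'I_(1 + M)) :
  ndiff k (fun theta : 'cV[R]_(nparams M N) => weightW theta i j).
Proof.
under eq_fun do rewrite /weightW !mxE.
exact: ndiff_coord.
Qed.

Lemma ndiff_weightV (j : 'I_(1 + N)) :
  ndiff k (fun theta : 'cV[R]_(nparams M N) => weightV theta 0 j).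
Proof.
under eq_fun do rewrite /weightV !mxE.
exact: ndiff_coord.
Qed.

Lemma ndiff_preact (xi : 'cV[R]_M) (i : 'I_N) :
  ndiff k (fun theta : 'cV[R]_(nparams M N) => preact xi theta i 0).
Proof.
under eq_fun do rewrite /preact mxE.
apply: ndiff_sum => j; apply: ndiffM; first exact: ndiff_weightW.
exact: ndiff_cst.
Qed.

Lemma ndiff_logit (xi : 'cV[R]_M) :
  ndiff k (fun theta : 'cV[R]_(nparams M N) => logit f xi theta).
Proof.
under eq_fun do rewrite /logit mxE.
apply: ndiff_sum => j; apply: ndiffM; first exact: ndiff_weightV.
rewrite /bias_ext; under eq_fun do rewrite mxE.
(* Either the constant bias entry 1, or the activation of a hidden unit. *)
case: (fintype.split j) => [i|i]; first exact: ndiff_cst.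
under eq_fun do rewrite mxE.
exact: ndiff_comp (ndiff_preact xi i).
Qed.

Lemma ndiff_loss : ndiff k (@loss R M N I f x q).
Proof.
rewrite /loss; under eq_fun do rewrite -mulN1r.
apply: ndiffM; first exact: ndiff_cst.
apply: ndiff_sum => i.
exact: ndiff_comp (ndiff_cross_entropy k (q i)%:R) (ndiff_logit (x i)).
Qed.

End network.

(** * Traces of the Hessian and of its square *)

Section hessian_trace.
Variables (R : realType) (M N I : nat) (f : R -> R) (x : 'I_I -> 'cV[R]_M).
Variables (q : 'I_I -> bool).
Hypothesis hf : three_times_differentiable f.

Lemma ndiff_hessL (i j : 'I_(nparams M N)) :
  ndiff 1 (fun theta => hessL f x q theta i j).
Proof.
under eq_fun do rewrite mxE.
(* Of the three orders, the second partial derivatives use two; the one left makes the entries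
   differentiable. *)
have [_ /(_ (delta_mx j 0)) [_ H]] := ndiff_loss N x q (ndiff_derive1n hf).
exact: H.
Qed.

Lemma ndiff_trH : ndiff 1 (@trH R M N I f x q).
Proof. by apply: ndiff_sum => i; exact: ndiff_hessL. Qed.

Lemma ndiff_trH2 : ndiff 1 (@trH2 R M N I f x q).
Proof.
apply: ndiff_sum => i; under eq_fun do rewrite mxE.
by apply: ndiff_sum => j; apply: ndiffM; exact: ndiff_hessL.
Qed.

End hessian_trace.

(** * Rules for gradients *)

Section grad.
Variables (R : realType) (n : nat).
Implicit Types (g h : 'cV[R]_n -> R) (a : 'cV[R]_n).

Lemma gradD g h a : differentiable g a -> differentiable h a ->
  grad (fun b => g b + h b) a = grad g a + grad h a.
Proof.
move=> dg dh; apply/colP => i; rewrite !mxE /partial.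
by rewrite -deriveD//; apply: diff_derivable.
Qed.

Lemma gradZ (c : R) g a : differentiable g a ->
  grad (fun b => c * g b) a = c *: grad g a.
Proof.
move=> dg; apply/colP => i; rewrite !mxE /partial.
by rewrite -[RHS]deriveZ//; apply: diff_derivable.
Qed.

Lemma grad_comp (phi : R -> R) g a (d : R) :
  differentiable g a -> is_derive (g a) 1 phi d ->
  grad (fun b => phi (g b)) a = d *: grad g a.
Proof.
move=> dg [dphi <-]; apply/colP => i; rewrite !mxE /partial.
exact: derive_comp_scalar.
Qed.

End grad.

Theorem theorem1 (R : realType) (M N I : nat)
    (hM : (1 <= M)%N) (hN : (1 <= N)%N) (hI : (1 <= I)%N)
    (f : R -> R) (hf : three_times_differentiable f)
    (x : 'I_I -> 'cV[R]_M) (q : 'I_I -> bool)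
    (theta : 'cV[R]_(nparams M N)) (hsigma : 0 < sigma f x q theta) :
  [/\ differentiable (trH f x q : 'cV[R]_(nparams M N) -> R) theta,
      differentiable (trH2 f x q : 'cV[R]_(nparams M N) -> R) theta,
      differentiable (mu f x q : 'cV[R]_(nparams M N) -> R) theta,
      differentiable (sigma f x q : 'cV[R]_(nparams M N) -> R) theta
    & differentiable (lambda_sup f x q : 'cV[R]_(nparams M N) -> R) theta]
  /\
  [/\ - grad (lambda_sup f x q) theta
      = - grad (mu f x q) theta
        - Num.sqrt ((nparams M N)%:R - 1) *: grad (sigma f x q) theta,
      grad (mu f x q) theta
      = (nparams M N)%:R^-1 *: grad (trH f x q) theta
    & grad (sigma f x q) theta
      = (2 * sigma f x q theta * (nparams M N)%:R)^-1
          *: grad (trH2 f x q) theta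
        - (mu f x q theta / sigma f x q theta) *: grad (mu f x q) theta].
Proof.
set D := (nparams M N)%:R : R.
have D0 : D != 0 by rewrite pnatr_eq0 nparamsE addn1.
have [dtr _] := ndiff_trH N x q hf.
have [dtr2 _] := ndiff_trH2 N x q hf.
have dmu : differentiable (mu f x q : 'cV[R]_(nparams M N) -> R) theta.
  exact: differentiableZ.
(* The eigenvalue variance, with the difference written as a sum so that [gradD] and [gradZ]
   apply. *)
pose var (b : 'cV[R]_(nparams M N)) := D^-1 * trH2 f x q b + - 1 * mu f x q b ^+ 2.
have sigmaE : sigma f x q = (fun b => Num.sqrt (var b)).
  by apply/funext => b; rewrite /var mulN1r.
have dmu2 : differentiable (fun b => mu f x q b ^+ 2 : R) theta.
  exact: (differentiableM dmu dmu).
have dvar1 : differentiable (fun b => D^-1 * trH2 f x q b) theta.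
  exact: differentiableZ.
have dvar2 : differentiable (fun b => - 1 * mu f x q b ^+ 2) theta.
  exact: (@differentiableZ _ _ _ _ (-1) _ dmu2).
have dvar : differentiable var theta by exact: differentiableD.
(* This keeps the radicand away from 0, where the square root is not differentiable. *)
have var0 : 0 < var theta by move: hsigma; rewrite sigmaE sqrtr_gt0.
have dsqrt := is_derive1_sqrt var0.
have dsigma : differentiable (sigma f x q : 'cV[R]_(nparams M N) -> R) theta.
  rewrite sigmaE; apply: differentiable_comp => //.
  by apply/derivable1_diffP; case: dsqrt.
have dlam2 : differentiable (fun b => Num.sqrt (D - 1) * sigma f x q b) theta.
  exact: differentiableZ.
have gmu : grad (mu f x q) theta = D^-1 *: grad (trH f x q) theta.
  exact: gradZ.
split; split => //.
- exact: differentiableD.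
- by rewrite -opprD -gradZ// -gradD.
have dsqr : is_derive (mu f x q theta) 1 (fun y : R => y ^+ 2)
    (2 * mu f x q theta).
  by apply: is_derive_eq; rewrite /GRing.scale/= mulr1 ?expr1 mulr_natl.
have s0 : sigma f x q theta != 0 by rewrite gt_eqF.
rewrite [in LHS]sigmaE (grad_comp dvar dsqrt) gradD// (gradZ _ (dtr2 theta)).
rewrite (gradZ _ dmu2) (grad_comp dmu dsqr).
rewrite -[Num.sqrt _]/((fun b => Num.sqrt (var b)) theta) -sigmaE.
(* The factor 1/(2 sigma) from the root meets 1/D in one term and -2 mu, from the square, in the
   other. *)
rewrite scalerDr !scalerA -scaleNr; congr (_ *: _ + _ *: _); field.
  by rewrite s0 D0.
exact: s0.
Qed.
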